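(* The rank variety $X(M)$ associated to a rank set $M=\{W_1,\dots,W_k\}$ for $G(k,n)$ is an irreducible subvariety of $G(k,n)$ of dimension $$\dim(X(M))=\sum_{i=1}^k\dim(W_i)-\sum_{i=1}^k\#\{W_j\in M\mid W_j\subseteq W_i\}.$$
   Context: Work over $\mathbb{C}$. Let $V$ be an $n$-dimensional vector space with fixed ordered basis $e_1,\dots,e_n$; $G(k,n)$ is the Grassmannian of $k$-dimensional subspaces of $V$. For $W=[e_i,e_j]:=\langle e_i,\dots,e_j\rangle$ ($i\le j$) put $l(W)=i$, $r(W)=j$. A rank set for $G(k,n)$ is a set $M=\{W_1,\dots,W_k\}$ of $k$ such subspaces with $l(W_i)\ne l(W_j)$ and $r(W_i)\neq r(W_j)$ for $i\ne j$. The rank variety $X(M)\subset G(k,n)$ is the Zariski closure of the set of $k$-planes having a basis $b_1,\dots,b_k$ with $b_i\in W_i$. *)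

(* Defs.v *)
From HB Require Import structures.
From mathcomp Require Import all_boot all_order all_algebra.
From mathcomp Require Import boolp classical_sets reals complex topology.
From mathcomp Require Import mpoly.

Set Implicit Arguments.
Unset Strict Implicit.
Unset Printing Implicit Defensive.

Import Order.TTheory GRing.Theory.

Local Open Scope classical_set_scope.
Local Open Scope ring_scope.

Section Dimension.
Variable T : topologicalType.
Implicit Types (A : set T) (Z : nat -> set T).

Definition irreducible A :=
  A !=set0 /\
  forall F G : set T, closed F -> closed G ->
    A `<=` F `|` G -> A `<=` F \/ A `<=` G.

(* Z_0 < ... < Z_m, irreducible and closed for the subspace topology of A;
   the values of Z beyond m are irrelevant. *)
Definition irreducible_chain A (m : nat) Z :=
  (forall i, (i <= m)%N ->
     irreducible (Z i) /\ exists2 F, closed F & Z i = A `&` F) /\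
  (forall i, (i < m)%N -> Z i `<` Z i.+1).

(* The Krull dimension of the subspace A is the natural number d. *)
Definition has_dim A (d : nat) :=
  (exists Z, irreducible_chain A d Z) /\
  (forall m Z, irreducible_chain A m Z -> (m <= d)%N).

End Dimension.

(* The basis e is a (phantom) parameter of the type because it indexes the
   Pluecker coordinates that define the topology. *)
Record grassmannian (k n : nat) (K : fieldType) (V : vectType K)
  (e : n.-tuple V) := Grassmannian {
    gr_space :> {vspace V};
    _ : \dim gr_space == k
  }.
Arguments grassmannian k {n K V} e.

HB.instance Definition _ k n (K : fieldType) (V : vectType K)
    (e : n.-tuple V) :=
  [isSub for @gr_space k n K V e].
HB.instance Definition _ k n (K : fieldType) (V : vectType K)
    (e : n.-tuple V) :=
  [Choice of grassmannian k e by <:].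

Definition increasing k n : {set {ffun 'I_k -> 'I_n}} :=
  [set s : {ffun 'I_k -> 'I_n} |
    [forall a : 'I_k, forall b : 'I_k, (a < b)%N ==> (s a < s b)%N]]%SET.

Section Zariski.
Variables (k n : nat) (K : fieldType) (V : vectType K) (e : n.-tuple V).

Notation nminors := #|increasing k n|.

(* Homogeneous coordinates of the image of U in the projective space of
   dimension binomial(n, k) - 1: maximal minors of the k x n matrix of
   coordinates in e of a basis of U.  Another basis of U rescales all of them
   by a common nonzero factor, so vanishing of a homogeneous polynomial does
   not depend on the choice of vbasis. *)
Definition plucker (U : grassmannian k e) (i : 'I_nminors) : K :=
  \det (\matrix_(a < k, c < k) coord e (enum_val i c) (vbasis U)`_a).

Definition homogeneous (f : {mpoly K[nminors]}) := exists d, f \is d.-homog.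

Definition zero_locus (F : set {mpoly K[nminors]}) : set (grassmannian k e) :=
  [set U | forall f, F f -> f.@[plucker U] = 0].

Definition zariski_open (A : set (grassmannian k e)) :=
  exists2 F, F `<=` homogeneous & A = ~` zero_locus F.

Lemma zariski_openT : zariski_open setT.
Proof.
exists [set 1] => [_ ->|]; first by exists 0; exact: dhomog1.
apply/esym; rewrite -subTset => U _ /(_ 1 erefl) /eqP.
by rewrite meval1 oner_eq0.
Qed.

Lemma zariski_openI A B :
  zariski_open A -> zariski_open B -> zariski_open (A `&` B).
Proof.
move=> [F hF ->] [G hG ->].
exists [set h | exists f g, [/\ F f, G g & h = f * g]].
  move=> _ [f [g [/hF[d fd] /hG[d' gd] ->]]].
  by exists (d + d')%N; exact: dhomogM.
rewrite -setCU; congr (~` _); apply/seteqP; split=> U.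
  move=> hU _ [f [g [Ff Gg ->]]]; rewrite mevalM.
  by case: hU => [/(_ f Ff)|/(_ g Gg)] ->; rewrite ?mul0r ?mulr0.
move=> hU; have [|nU] := pselect (zero_locus F U); first by left.
right=> g Gg; apply: contrapT => g0; apply: nU => f Ff.
have /eqP := hU (f * g) (ex_intro _ f (ex_intro _ g (And3 Ff Gg erefl))).
by rewrite mevalM mulf_eq0 => /orP[/eqP//|/eqP].
Qed.

Lemma zariski_open_bigU (I : Type) (A : I -> set (grassmannian k e)) :
  (forall i, zariski_open (A i)) -> zariski_open (\bigcup_i A i).
Proof.
move=> oA; exists [set f | homogeneous f /\
    forall U, f.@[plucker U] != 0 -> (\bigcup_i A i) U] => [f []//|].
apply/seteqP; split=> U.
  move=> [i _ AiU] hU; have [F hF AE] := oA i.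
  move: (AiU); rewrite AE; apply=> f Ff; apply: hU; split; first exact: hF.
  by move=> U' /eqP f0; exists i => //; rewrite AE => /(_ f Ff).
move=> nU; apply: contrapT => hU; apply: nU => f [_ hf].
by apply/eqP/negPn/negP => /hf.
Qed.

HB.instance Definition _ := isOpenTopological.Build (grassmannian k e)
  zariski_openT zariski_openI zariski_open_bigU.

Lemma zariski_closedP (Z : set (grassmannian k e)) :
  closed Z <-> exists2 F, F `<=` homogeneous & Z = zero_locus F.
Proof.
rewrite -openC; split=> -[F hF ZE]; exists F => //; last by rewrite ZE.
by rewrite -[Z]setCK ZE setCK.
Qed.

End Zariski.

(* A labelling W_0, ..., W_(k-1) of a rank set, each W_i = [e_l, e_r] being
   recorded by its end points; indices start at 0. *)
Record rank_set (k n : nat) := RankSet {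
  lft : 'I_k -> 'I_n;
  rgt : 'I_k -> 'I_n;
  lft_le_rgt : forall i, (lft i <= rgt i)%N;
  lft_inj : injective lft;
  rgt_inj : injective rgt
}.

Section RankVariety.
Variables (k n : nat) (K : fieldType) (V : vectType K) (e : n.-tuple V).
Variable M : rank_set k n.

Definition rank_space (i : 'I_k) : {vspace V} :=
  <<[seq e`_j | j <- index_iota (lft M i) (rgt M i).+1]>>%VS.

Definition rank_variety : set (grassmannian k e) :=
  closure [set U : grassmannian k e | exists b : k.-tuple V,
    basis_of U b /\ forall i, tnth b i \in rank_space i].

End RankVariety.

Arguments rank_space {k n K V} e M i.
Arguments rank_variety {k n K V} e M.

(* Main.v *)
Require Import Defs.
From mathcomp Require Import all_boot all_order all_algebra all_fingroup.
From mathcomp Require Import boolp classical_sets reals complex topology.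
From mathcomp Require Import mpoly zify.

(** Let W_i = [e_(l i), e_(r i)].  Call j nested in i when W_j is contained in
    W_i.  Given a plane spanned by vectors b_i in W_i whose coordinates
    b_i(l i) are nonzero, multiples of the b_j with j nested in i can be
    subtracted from b_i without leaving W_i; since the l j are distinct, this
    clears the coordinates l j and normalises b_i(l i) to 1
    (normal_form_reduction).  The remaining free coordinates are the pairs
    (i, c) with c in [l i, r i] and c different from all l j, j nested in i.
    Their number is exactly the announced dimension d (card_free_positions),
    and X(M) is the closure of the image of the affine space K^d under the
    normal form (rank_variety_cell): planes with some b_i(l i) = 0 are limits
    along the lines b_i + t e_(l i).

    Irreducibility: two points of the image of an affine subspace L of K^d are
    joined by a line of matrices with rows spanning planes of that image.  A
    form vanishes along the line as soon as a polynomial in one variable is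
    zero, and K[t] is a domain (irreducible_curves).

    Lower bound for the dimension: at a base point of K^d that works for all
    the free coordinates at once, each of them is a quotient of two Pluecker
    coordinates with nonzero denominator (chart_ratio,
    chart_den_base_point).  Hence the closures of the images of a complete
    flag of coordinate subspaces through the base point form a strictly
    increasing chain of length d (flag_strict).

    Upper bound: a chain Z_0 < ... < Z_m of irreducible closed sets yields
    forms f_j vanishing on Z_(j-1) but not on Z_j, and a linear form g not
    vanishing on Z_0.  The products of powers f_j ^ q_j with q_j < t, filled up
    with powers of g, are t ^ m forms of one degree O(t) which are linearly
    independent on Z_m (chain_independent).  If Z_m is contained in X(M), their
    pullbacks to K^d are linearly independent polynomials of degree O(t) in d
    variables, and those span a space of dimension O(t ^ d).  So m <= d
    (chain_length_le). *)

Set Implicit Arguments.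
Unset Strict Implicit.
Unset Printing Implicit Defensive.

Import Order.TTheory GRing.Theory.

Local Open Scope classical_set_scope.
Local Open Scope ring_scope.

(** * Determinants and maximal minors *)

(** A permutation preserves the total weight, so the identity is the only one
    that can pick nonzero entries everywhere.  Working with a weight avoids
    reordering the rows into an honest triangular matrix. *)
Lemma det_triangular_weight (B : comPzRingType) (k : nat) (rho : 'I_k -> nat)
    (A : 'M[B]_k) :
  (forall i j, i != j -> A i j != 0 -> (rho i < rho j)%N) ->
  \det A = \prod_i A i i.
Proof.
move=> hA; rewrite /determinant (bigD1 (1%g : 'S_k)) //= [X in _ + X]big1 ?addr0.
  rewrite odd_perm1 expr0 mul1r.
  by apply: eq_bigr => i _; rewrite perm1.
move=> s s1; suff [i si Ai] : exists2 i, s i != i & A i (s i) = 0.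
  by rewrite (bigD1 i) //= Ai mul0r mulr0.
apply: contrapT => nA.
have hle i : (rho i <= rho (s i))%N.
  have [->//|si] := eqVneq (s i) i.
  apply/ltnW/hA; first by rewrite eq_sym.
  by apply/eqP => Ai; apply: nA; exists i.
have [i si] : exists i, s i != i.
  apply: contrapT => h; case/eqP: s1; apply/permP => i; rewrite perm1.
  by apply/eqP/negPn/negP => si; apply: h; exists i.
have lt : (rho i < rho (s i))%N.
  apply: hA; first by rewrite eq_sym.
  by apply/eqP => Ai; apply: nA; exists i.
have : (\sum_i rho i < \sum_i rho (s i))%N.
  rewrite (bigD1 i) //= [X in (_ < X)%N](bigD1 i) //=.
  by rewrite -addSn leq_add // leq_sum.
by rewrite [X in (X < _)%N](reindex_inj (@perm_inj _ s)) ltnn.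
Qed.

Section Minors.
Variables (k n : nat).
Local Notation N := #|increasing k n|.

Definition minors (B : comPzRingType) (A : 'M[B]_(k, n)) (i : 'I_N) : B :=
  \det (\matrix_(a < k, c < k) A a (enum_val i c)).

Lemma minors_mulmx (B : comPzRingType) (g : 'M[B]_k) (A : 'M[B]_(k, n)) i :
  minors (g *m A) i = \det g * minors A i.
Proof.
rewrite /minors -det_mulmx; congr (\det _); apply/matrixP => a c.
by rewrite !mxE; apply: eq_bigr => b _; rewrite mxE.
Qed.

Lemma minors_map (B C : comPzRingType) (phi : {rmorphism B -> C})
    (A : 'M[B]_(k, n)) i :
  minors (map_mx phi A) i = phi (minors A i).
Proof.
rewrite /minors -det_map_mx; congr (\det _); apply/matrixP => a c.
by rewrite !mxE.
Qed.

Lemma sorting_perm (c : 'I_k -> 'I_n) : injective c ->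
  exists s : 'S_k, forall a b : 'I_k, (a < b)%N -> (c (s a) < c (s b))%N.
Proof.
move=> cI.
have rk_lt (a : 'I_k) : (#|[set b : 'I_k | (c b < c a)%N]%SET| < k)%N.
  rewrite -[X in (_ < X)%N]card_ord -cardsT; apply: proper_card.
  apply/properP; split; first exact: finset.subsetT.
  by exists a; rewrite ?inE ?ltnn.
pose rk a := Ordinal (rk_lt a).
have rk_mono a b : (c a < c b)%N -> (rk a < rk b)%N.
  move=> ab; apply: proper_card; apply/properP; split.
    by apply/fintype.subsetP => x; rewrite !inE => /ltn_trans; apply.
  by exists a; rewrite !inE ?ltnn.
have rkI : injective rk.
  move=> a b ab; apply: cI; apply: val_inj.
  by case: (ltngtP (c a) (c b)) => // /rk_mono; rewrite ab ltnn.
exists (perm rkI)^-1%g => a b ab; rewrite ltnNge leq_eqVlt negb_or.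
have rkK x : rk ((perm rkI)^-1%g x) = x by rewrite -[rk _](permE rkI) permKV.
apply/andP; split; last first.
  by apply/negP => /rk_mono; rewrite !rkK ltnNge (ltnW ab).
apply/eqP => /val_inj/cI/perm_inj ba; move: ab.
by rewrite ba ltnn.
Qed.

(** Pluecker coordinates are indexed by increasing column choices only; any
    other choice of columns is sorted at the price of a sign, or repeats a
    column and gives the zero form. *)
Lemma minor_form (K : fieldType) (c : 'I_k -> 'I_n) :
  exists2 p : {mpoly K[N]}, p \is 1.-homog &
    forall A : 'M[K]_(k, n),
      p.@[minors A] = \det (\matrix_(a < k, b < k) A a (c b)).
Proof.
have [cI|ncI] := pselect (injective c); last first.
  exists 0 => [|A]; first exact: dhomog0.
  rewrite meval0; apply/esym.
  have [a [b [ab cab]]] : exists a b, a != b /\ c a = c b.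
    apply: contrapT => h; apply: ncI => a b ab; apply: contrapT => /eqP n_ab.
    by apply: h; exists a, b.
  rewrite -det_tr; apply: (determinant_alternate ab) => i.
  by rewrite !mxE cab.
have [s hs] := sorting_perm cI.
pose t : {ffun 'I_k -> 'I_n} := [ffun a => c (s a)].
have tinc : t \in increasing k n.
  rewrite inE; apply/forallP => a; apply/forallP => b; apply/implyP => ab.
  by rewrite !ffunE hs.
pose i := enum_rank_in tinc t.
exists ((-1) ^+ s *: 'X_i) => [|A].
  by apply: dhomogZ; rewrite dhomogX; apply/eqP; exact: mdeg1.
rewrite mevalZ mevalXU /minors.
have -> : \matrix_(a < k, b < k) A a (enum_val i b)
    = col_perm s (\matrix_(a < k, b < k) A a (c b)).
  by apply/matrixP => a b; rewrite !mxE enum_rankK_in // ffunE.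
by rewrite col_permE det_mulmx det_perm odd_permV mulrCA -expr2 sqrr_sign
  mulr1.
Qed.

End Minors.

(** * Planes as row spaces of matrices *)

Lemma rmorph_mmap (N : nat) (R : nzRingType) (S T : comNzRingType)
    (phi : {rmorphism S -> T}) (f : R -> S) (h : 'I_N -> S) (p : {mpoly R[N]}) :
  phi (mmap f h p) = mmap (phi \o f) (phi \o h) p.
Proof.
rewrite /mmap rmorph_sum; apply: eq_bigr => m _.
rewrite rmorphM /mmap1 rmorph_prod; congr (_ * _).
by apply: eq_bigr => i _; rewrite rmorphXn.
Qed.

Lemma eq_mmap (N : nat) (R S : nzRingType) (f g : R -> S) (h l : 'I_N -> S)
    (p : {mpoly R[N]}) :
  f =1 g -> h =1 l -> mmap f h p = mmap g l p.
Proof.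
by move=> fg hl; apply: eq_bigr => m _; rewrite fg (mmap1_eq _ hl).
Qed.

Lemma meval_homog (N : nat) (R : comNzRingType) (p : {mpoly R[N]}) d (a : R) v w :
  p \is d.-homog -> (forall i, w i = a * v i) -> p.@[w] = a ^+ d * p.@[v].
Proof.
move=> /dhomogP ph wE; rewrite !mevalE mulr_sumr big_seq [RHS]big_seq.
apply: eq_bigr => m /ph md; rewrite mulrCA; congr (_ * _).
rewrite -(md : mdeg m = d) mdegE expr_sum -big_split /=.
by apply: eq_bigr => i _; rewrite wE exprMn.
Qed.

(** An infinite field is presented as one that no list exhausts. *)
Lemma infinite_nonroot (K : fieldType) (P : {poly K}) :
  (forall s : seq K, exists x, x \notin s) -> P != 0 -> exists x, P.[x] != 0.
Proof.
move=> Kinf P0.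
have [s hs] : exists s : seq K, forall x, root P x -> x \in s.
  (* Otherwise lists of distinct roots could be extended indefinitely. *)
  apply: contrapT => h.
  suff H m : exists s : seq K, [/\ uniq s, all (root P) s & size s = m].
    have [s [us rs]] := H (size P); move=> ss.
    by have := max_poly_roots P0 rs us; rewrite ss ltnn.
  elim: m => [|m [s [us rs ss]]]; first by exists [::].
  have [x [rx xs]] : exists x, root P x /\ x \notin s.
    apply: contrapT => h'; apply: h; exists s => x rx; apply/negPn/negP => xs.
    by apply: h'; exists x.
  by exists (x :: s); rewrite /= xs us rx rs ss.
have [x xs] := Kinf s; exists x.
by apply: contra xs => /hs.
Qed.

Section Rows.
Variables (k n : nat) (K : fieldType) (V : vectType K) (e : n.-tuple V).
Hypothesis he : basis_of fullv e.
Local Notation N := #|increasing k n|.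
Local Notation Gr := (grassmannian k e).

Definition rows m (A : 'M[K]_(m, n)) : m.-tuple V :=
  [tuple \sum_c A a c *: e`_c | a < m].

Lemma nth_rows m (A : 'M[K]_(m, n)) (a : 'I_m) : (rows A)`_a = \sum_c A a c *: e`_c.
Proof. by rewrite -tnth_nth tnth_mktuple. Qed.

Lemma coord_rows m (A : 'M[K]_(m, n)) (a : 'I_m) c : coord e c (rows A)`_a = A a c.
Proof. by rewrite nth_rows coord_sum_free // (basis_free he). Qed.

Lemma rows_sub_factor l m (A : 'M[K]_(l, n)) (B : 'M[K]_(m, n)) :
  {subset rows B <= <<rows A>>%VS} -> exists g, B = g *m A.
Proof.
move=> sBA; exists (\matrix_(a, i) coord (rows A) i (rows B)`_a).
apply/matrixP => a c; rewrite -[LHS]coord_rows.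
have /coord_span -> : (rows B)`_a \in <<rows A>>%VS.
  by apply: sBA; rewrite -tnth_nth mem_tnth.
rewrite linear_sum !mxE; apply: eq_bigr => i _.
by rewrite linearZ /= coord_rows !mxE.
Qed.

Definition coord_mx m (b : m.-tuple V) : 'M[K]_(m, n) :=
  \matrix_(a, c) coord e c b`_a.

Lemma coord_mxK m (b : m.-tuple V) : rows (coord_mx b) = b.
Proof.
apply: eq_from_tnth => a; rewrite tnth_mktuple [RHS](tnth_nth 0).
rewrite [RHS](coord_basis he) ?memvf //.
by apply: eq_bigr => c _; rewrite mxE.
Qed.

Definition spans (A : 'M[K]_(k, n)) (U : Gr) := <<rows A>>%VS = gr_space U.

Lemma dim_gr (U : Gr) : \dim (gr_space U) = k.
Proof. by apply/eqP; exact: (valP U). Qed.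

Definition gr_mx (U : Gr) : 'M[K]_(k, n) :=
  \matrix_(a, c) coord e c (vbasis U)`_a.

Lemma span_gr_mx U : spans (gr_mx U) U.
Proof.
rewrite /spans -[RHS](span_basis (vbasisP U)); congr (<<_>>%VS).
apply: (@eq_from_nth _ 0) => [|i]; rewrite !size_tuple ?dim_gr // => ik.
rewrite (nth_rows _ (Ordinal ik)) [RHS](coord_basis he) ?memvf //.
by apply: eq_bigr => c _; rewrite mxE.
Qed.

Lemma plucker_minors U i : plucker U i = minors (gr_mx U) i.
Proof.
by rewrite /plucker /minors; congr (\det _); apply/matrixP => a c; rewrite !mxE.
Qed.

(** Each of two matrices with the same row space is a square matrix times the
    other; its minors are then those of the other times a determinant. *)
Lemma spans_plucker A U f : spans A U -> homogeneous f ->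
  f.@[minors A] = 0 <-> f.@[plucker U] = 0.
Proof.
move=> AU [d fd]; have BU := span_gr_mx U.
have [g gE] : exists g, A = g *m gr_mx U.
  by apply: rows_sub_factor => v vA; rewrite BU -AU memv_span.
have [h hE] : exists h, gr_mx U = h *m A.
  by apply: rows_sub_factor => v vA; rewrite AU -BU memv_span.
split=> f0.
  rewrite (@meval_homog _ _ f d (\det h) (minors A)) ?f0 ?mulr0 // => i.
  by rewrite plucker_minors {1}hE minors_mulmx.
rewrite (@meval_homog _ _ f d (\det g) (plucker U)) ?f0 ?mulr0 // => i.
by rewrite plucker_minors {1}gE minors_mulmx.
Qed.

Lemma free_rows_span (A : 'M[K]_(k, n)) :
  row_free A -> exists U, spans A U.
Proof.
move=> Af; suff dk : \dim <<rows A>>%VS == k by exists (Grassmannian e dk).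
have : free (rows A).
  apply/freeP => c c0 i; have /eqP : \row_i c i *m A = 0.
    apply/rowP => j; rewrite !mxE.
    have := congr1 (coord e j) c0; rewrite linear_sum linear0 => h.
    by rewrite -[RHS]h; apply: eq_bigr => a _; rewrite linearZ /= coord_rows mxE.
  by rewrite mulmx_free_eq0 // => /eqP/rowP/(_ i); rewrite !mxE.
by rewrite /free size_tuple.
Qed.

Lemma gr_mx_free U : row_free (gr_mx U).
Proof.
rewrite -kermx_eq0; apply/rowV0P => v /sub_kermxP vM.
have hb : free (rows (gr_mx U)).
  by rewrite /free (span_gr_mx U) size_tuple dim_gr.
have /freeP/(_ (v 0)) fr := hb.
apply/rowP => i; rewrite mxE; apply: fr.
transitivity (\sum_c (v *m gr_mx U) 0 c *: e`_c).
  under eq_bigr do rewrite nth_rows scaler_sumr.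
  rewrite exchange_big; apply: eq_bigr => c _ /=; rewrite mxE scaler_suml.
  by apply: eq_bigr => a _; rewrite scalerA.
by rewrite vM big1 // => c _; rewrite mxE scale0r.
Qed.

(** The Pluecker coordinates define a point of the projective space: a matrix of
    full rank has a nonzero maximal minor. *)
Lemma plucker_neq0 (U : Gr) :
  exists2 g : {mpoly K[N]}, g \is 1.-homog & g.@[plucker U] != 0.
Proof.
have fU : row_full (gr_mx U)^T.
  by rewrite /row_full mxrank_tr; exact: gr_mx_free.
have [g g1 gE] := minor_form K (fullrankfun fU).
exists g => //.
have -> : g.@[plucker U] = g.@[minors (gr_mx U)].
  by apply: meval_eq => i; rewrite plucker_minors.
rewrite gE -unitfE -unitmxE -unitmx_tr.
have := fullrowsub_unit fU; congr (_ \in unitmx).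
by apply/matrixP => a b; rewrite !mxE.
Qed.

End Rows.

(** * Irreducibility and closures in the Zariski topology *)

Lemma closure_sub (T : topologicalType) (A F : set T) :
  closed F -> A `<=` F -> closure A `<=` F.
Proof. by move=> /closure_id {2}-> /closureS. Qed.

Lemma irreducible_closure (T : topologicalType) (A : set T) :
  irreducible A -> irreducible (closure A).
Proof.
move=> [[x Ax] irr]; split; first by exists x; exact: subset_closure.
move=> F G cF cG cov.
have [AF|AG] := irr F G cF cG (subset_trans (@subset_closure _ A) cov).
  by left; exact: closure_sub.
by right; exact: closure_sub.
Qed.

Section ZariskiTopology.
Variables (k n : nat) (K : fieldType) (V : vectType K) (e : n.-tuple V).
Local Notation N := #|increasing k n|.
Local Notation Gr := (grassmannian k e).

Definition vanishes_on (f : {mpoly K[N]}) (Z : set Gr) :=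
  forall U, Z U -> f.@[plucker U] = 0.

Lemma closed_zeros f : homogeneous f -> closed [set U : Gr | f.@[plucker U] = 0].
Proof.
move=> hf; apply/zariski_closedP; exists [set f] => [_ ->//|].
by apply/seteqP; split=> U /= h; [move=> _ -> | exact: h].
Qed.

Lemma closed_separation (Z : set Gr) U : closed Z -> ~ Z U ->
  exists f, [/\ homogeneous f, vanishes_on f Z & f.@[plucker U] != 0].
Proof.
move=> /zariski_closedP[F hF ->] nU; apply: contrapT => h; apply: nU => f Ff.
apply: contrapT => /eqP f0; apply: h; exists f.
by split=> // [|W]; [exact: hF | apply].
Qed.

Lemma vanishes_on_closure f Z : homogeneous f -> vanishes_on f Z ->
  vanishes_on f (closure Z).
Proof. by move=> hf fZ; exact: (closure_sub (closed_zeros hf) fZ). Qed.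

Lemma mem_closureP (Z : set Gr) U :
  (forall f, homogeneous f -> vanishes_on f Z -> f.@[plucker U] = 0) ->
  closure Z U.
Proof.
move=> h; apply: contrapT => /(closed_separation (@closed_closure _ Z)).
move=> [f [hf fZ /eqP]]; apply; apply: h => // W ZW.
exact/fZ/subset_closure.
Qed.

Lemma vanishes_onM Z f g : irreducible Z -> homogeneous f -> homogeneous g ->
  vanishes_on (f * g) Z -> vanishes_on f Z \/ vanishes_on g Z.
Proof.
move=> [_ irr] hf hg fg0; apply: (irr _ _ (closed_zeros hf) (closed_zeros hg)).
move=> U /fg0/eqP; rewrite mevalM mulf_eq0.
by case/orP=> /eqP h; [left|right].
Qed.

Hypothesis he : basis_of fullv e.
Hypothesis Kinf : forall s : seq K, exists x, x \notin s.

Definition at_mx (A : 'M[{poly K}]_(k, n)) (t : K) : 'M[K]_(k, n) :=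
  map_mx (horner_eval t) A.

(** Along a polynomial curve of matrices, a form in the minors is a polynomial in
    the parameter of the curve. *)
Lemma pullback_line (A : 'M[{poly K}]_(k, n)) (f : {mpoly K[N]}) :
  exists P : {poly K}, forall t, P.[t] = f.@[minors (at_mx A t)].
Proof.
exists (mmap polyC (minors A) f) => t; rewrite -[LHS]/(horner_eval t _).
rewrite rmorph_mmap; apply: eq_mmap => [c|i] /=; last by rewrite minors_map.
exact: hornerC.
Qed.

(** A form vanishing on S vanishes at all but finitely many points of the curve,
    hence, the field being infinite, at its origin as well. *)
Lemma curve_limit (S : set Gr) U (A : 'M[{poly K}]_(k, n)) (Q : {poly K}) :
  spans (at_mx A 0) U -> Q != 0 ->
  (forall t, Q.[t] != 0 -> exists2 W, S W & spans (at_mx A t) W) ->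
  closure S U.
Proof.
move=> AU Q0 h; apply: mem_closureP => f hf fS.
have [P PE] := pullback_line A f.
apply/(spans_plucker he AU hf); rewrite -PE.
suff -> : P = 0 by rewrite horner0.
apply: contrapT => /eqP P0.
have [t] := infinite_nonroot Kinf (mulf_neq0 P0 Q0).
rewrite hornerM mulf_eq0 negb_or => /andP[Pt Qt].
have [W SW AW] := h t Qt.
by move/eqP: Pt; apply; rewrite PE; apply/(spans_plucker he AW hf)/fS.
Qed.

(** If S were not contained in the closed sets F and G, there would be forms f, g
    vanishing on F, G but not at some U1, U2 in S.  Their pullbacks to a curve
    through U1 and U2 are nonzero polynomials, so f and g are both nonzero at
    some point of the curve: S is not contained in the union of F and G. *)
Lemma irreducible_curves (S : set Gr) : S !=set0 ->
  (forall U1 U2, S U1 -> S U2 -> exists A : 'M[{poly K}]_(k, n),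
     [/\ spans (at_mx A 0) U1, spans (at_mx A 1) U2 &
         forall t, exists2 W, S W & spans (at_mx A t) W]) ->
  irreducible S.
Proof.
move=> S0 h; split=> // F G cF cG SFG; apply: contrapT => nFG.
have out H : ~ S `<=` H -> exists2 U, S U & ~ H U.
  move=> nH; apply: contrapT => no; apply: nH => U SU.
  by apply: contrapT => HU; apply: no; exists U.
have [U1 S1 F1] : exists2 U, S U & ~ F U by apply: out => ?; apply: nFG; left.
have [U2 S2 G2] : exists2 U, S U & ~ G U by apply: out => ?; apply: nFG; right.
have [A [A1 A2 At]] := h _ _ S1 S2.
have [f [hf fF /eqP f1]] := closed_separation cF F1.
have [g [hg gG /eqP g2]] := closed_separation cG G2.
have [P PE] := pullback_line A f; have [Q QE] := pullback_line A g.
have P0 : P != 0.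
  apply/eqP => P0; apply/f1/(spans_plucker he A1 hf).
  by rewrite -PE P0 horner0.
have Q0 : Q != 0.
  apply/eqP => Q0; apply/g2/(spans_plucker he A2 hg).
  by rewrite -QE Q0 horner0.
have [t] := infinite_nonroot Kinf (mulf_neq0 P0 Q0).
rewrite hornerM mulf_eq0 negb_or => /andP[/eqP Pt /eqP Qt].
have [W SW AW] := At t; case: (SFG W SW) => [/fF|/gG] W0.
  by apply: Pt; rewrite PE; apply/(spans_plucker he AW hf).
by apply: Qt; rewrite QE; apply/(spans_plucker he AW hg).
Qed.

End ZariskiTopology.

(** * Chains of irreducible sets are no longer than the number of parameters *)

Lemma msizeM_leS (d : nat) (K : fieldType) (p q : {mpoly K[d]}) a b :
  (msize p <= a.+1)%N -> (msize q <= b.+1)%N -> (msize (p * q) <= (a + b).+1)%N.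
Proof.
move=> pa qb.
have [->|p0] := eqVneq p 0; first by rewrite mul0r msize0.
have [->|q0] := eqVneq q 0; first by rewrite mulr0 msize0.
by rewrite msizeM // -subn1 leq_subLR (leq_trans (leq_add pa qb)) // addSn addnS.
Qed.

Lemma msize_mmap_homog (d N D w : nat) (K : fieldType)
    (v : 'I_N -> {mpoly K[d]}) (p : {mpoly K[N]}) :
  (forall i, (msize (v i) <= D.+1)%N) -> p \is w.-homog ->
  (msize (mmap (@mpolyC d K) v p) <= (w * D).+1)%N.
Proof.
move=> vD /dhomogP pw; rewrite /mmap big_seq.
apply: (leq_trans (msize_sum _ _ _)); apply/bigmax_leqP_seq => m _ /pw mw.
rewrite mul_mpolyC (leq_trans (msizeZ_le _ _)) // -(mw : mdeg m = w).
rewrite /mmap1 mdegE big_distrl /=.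
elim/big_ind2: _ => [|a p1 b p2 pa pb|i _]; first by rewrite msize1.
  exact: msizeM_leS.
elim: (m i) => [|j IH]; first by rewrite expr0 msize1.
by rewrite exprS mulSn; exact: msizeM_leS.
Qed.

(** The coefficients of a polynomial of total degree at most b have all their
    exponents below b + 1: this crude bound on the dimension of the space of
    such polynomials is sharp enough, as only its order of growth in b
    matters. *)
Lemma mpoly_dependent (d b : nat) (K : fieldType) (I : finType)
    (h : I -> {mpoly K[d]}) :
  (forall i, (msize (h i) <= b.+1)%N) -> (b.+1 ^ d < #|I|)%N ->
  exists c : I -> K, (exists i, c i != 0) /\ \sum_i c i *: h i = 0.
Proof.
move=> hb lt; pose T := {ffun 'I_d -> 'I_b.+1}.
pose mon (f : T) : 'X_{1..d} := [multinom (f j : nat) | j < d].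
pose M : 'M[K]_(#|I|, #|T|) :=
  \matrix_(i, j) (h (enum_val i))@_(mon (enum_val j)).
have : ~~ row_free M.
  rewrite /row_free neq_ltn (leq_ltn_trans (rank_leq_col M)) //.
  by rewrite card_ffun !card_ord.
rewrite -kermx_eq0 => /rowV0Pn[v /sub_kermxP vM v0].
exists (fun i => v 0 (enum_rank i)); split.
  have [i vi] : exists i, v 0 i != 0.
    apply: contrapT => no; case/eqP: v0; apply/rowP => i; rewrite mxE.
    by apply/eqP/negPn/negP => vi; apply: no; exists i.
  by exists (enum_val i); rewrite enum_valK.
apply/mpolyP => m; rewrite raddf_sum mcoeff0 /=.
have [mb|] := boolP [forall j, m j < b.+1]%N; last first.
  rewrite negb_forall => /existsP[j]; rewrite -leqNgt => mj.
  apply: big1 => i _; rewrite mcoeffZ memN_msupp_eq0 ?mulr0 //.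
  apply: msize_mdeg_ge; rewrite (leq_trans (hb i)) // (leq_trans mj) //.
  by rewrite mdegE (bigD1 j) //= leq_addr.
have mE : m = mon [ffun j => inord (m j)].
  apply/mnmP => j; rewrite mnmE ffunE inordK //.
  by move/forallP/(_ j): mb.
have := congr1 (fun A : 'rV_#|T| => A 0 (enum_rank [ffun j => inord (m j)])) vM.
rewrite !mxE => h0; rewrite -[RHS]h0.
rewrite (reindex_onto (@enum_val I predT) enum_rank) /=;
  last by move=> i _; rewrite enum_rankK.
apply: eq_big => [i|i _]; first by rewrite enum_valK eqxx.
by rewrite mcoeffZ enum_valK mxE enum_rankK -mE.
Qed.

Lemma meval_sumZ (N : nat) (K : fieldType) (I : finType) (c : I -> K)
    (h : I -> {mpoly K[N]}) v :
  (\sum_i c i *: h i).@[v] = \sum_i c i * (h i).@[v].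
Proof. by rewrite raddf_sum; apply: eq_bigr => i _; rewrite /= mevalZ. Qed.

Section Chains.
Variables (k n : nat) (K : fieldType) (V : vectType K) (e : n.-tuple V).
Local Notation N := #|increasing k n|.
Local Notation Gr := (grassmannian k e).
Hypothesis he : basis_of fullv e.

Definition independent_on (I : finType) (h : I -> {mpoly K[N]}) (Z : set Gr) :=
  forall c : I -> K, vanishes_on (\sum_i c i *: h i) Z -> forall i, c i = 0.

Lemma homogeneous_sum (I : finType) (P : pred I) (c : I -> K)
    (h : I -> {mpoly K[N]}) w :
  (forall i, P i -> h i \is w.-homog) -> \sum_(i | P i) c i *: h i \is w.-homog.
Proof. by move=> hw; apply: rpred_sum => i Pi; apply: dhomogZ; exact: hw. Qed.

(** In a linear relation on Z' between the products f ^ q * g ^ (...) * h_i, let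
    q be the least exponent of f that occurs.  As Z' is irreducible and f is not
    identically zero on it, f ^ q can be cancelled.  Restricting to Z kills the
    terms that still contain f; there g can be cancelled in turn, which leaves a
    relation between the h_i. *)
Lemma independent_extend (Z Z' : set Gr) (f g : {mpoly K[N]}) (delta w t : nat)
    (I : finType) (h : I -> {mpoly K[N]}) :
  irreducible Z -> irreducible Z' -> Z `<=` Z' ->
  f \is delta.-homog -> vanishes_on f Z -> ~ vanishes_on f Z' ->
  g \is 1.-homog -> ~ vanishes_on g Z ->
  (forall i, h i \is w.-homog) -> independent_on h Z ->
  exists h' : 'I_t * I -> {mpoly K[N]},
    (forall i, h' i \is (delta * t + w).-homog) /\ independent_on h' Z'.
Proof.
move=> iZ iZ' ZZ' fd fZ fZ' g1 gZ hw hI.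
(* The power of g makes all products homogeneous of the same degree. *)
pose F (q0 : nat) (x : 'I_t * I) :=
  f ^+ (x.1 - q0) * g ^+ (delta * (t - x.1)) * h x.2.
have Fh q0 (x : 'I_t * I) : (q0 <= x.1)%N ->
    F q0 x \is (delta * (t - q0) + w).-homog.
  move=> q0x.
  have -> : (delta * (t - q0) + w
      = delta * (x.1 - q0) + 1 * (delta * (t - x.1)) + w)%N.
    rewrite mul1n -mulnDr; congr (_ * _ + _)%N.
    by rewrite addnC addnBA // subnK // ltnW.
  by rewrite /F; do 2![apply: dhomogM => //]; exact: dhomogMn.
exists (F 0); split => [x|c cZ']; first by have := @Fh 0 x isT; rewrite subn0.
(* Induction on the exponent q of f, smaller exponents having coefficient 0. *)
suff H q : forall x : 'I_t * I, (x.1 = q :> nat) -> c x = 0 by move=> x; apply: H.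
elim/ltn_ind: q => q IH.
have [qt|tq] := ltnP q t; last first.
  by move=> x xq; move: (ltn_ord x.1); rewrite xq ltnNge tq.
pose E := \sum_(x : 'I_t * I | (q <= x.1)%N) c x *: F q x.
have hE : homogeneous E.
  by exists (delta * (t - q) + w)%N; apply: homogeneous_sum => x; exact: Fh.
have fqE : \sum_x c x *: F 0 x = f ^+ q * E.
  rewrite (bigID (fun x : 'I_t * I => q <= x.1)%N) /=.
  rewrite [X in _ + X]big1 ?addr0; last first.
    by move=> x; rewrite -ltnNge => /IH -> //; rewrite scale0r.
  rewrite mulr_sumr; apply: eq_bigr => x qx.
  by rewrite -scalerAr /F !mulrA -exprD subn0 subnKC.
have EZ' : vanishes_on E Z'.
  move: cZ'; rewrite fqE => /(vanishes_onM iZ') [||fq0|//]; last first.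
  - case: fZ' => U /fq0; rewrite rmorphXn => /eqP; rewrite expf_eq0.
    by case/andP=> _ /eqP.
  - exact: hE.
  - by exists (delta * q)%N; exact: dhomogMn.
have gZ0 : vanishes_on (g ^+ (delta * (t - q)) *
    \sum_i c (Ordinal qt, i) *: h i) Z.
  move=> U ZU; rewrite -(EZ' U (ZZ' U ZU)) mevalM meval_sumZ mulr_sumr.
  rewrite /E raddf_sum /=.
  rewrite (bigID (fun x : 'I_t * I => x.1 == Ordinal qt)) /= [X in _ = _ + X]big1.
    rewrite addr0 [RHS](reindex_onto (fun i : I => (Ordinal qt, i)) snd) /=.
      apply: eq_big => [i|i _]; first by rewrite leqnn !eqxx.
      by rewrite mevalZ /F subnn expr0 mul1r mevalM mulrCA.
    by move=> [x i] /= /andP[_ /eqP ->].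
  move=> x /andP[qx xq]; rewrite mevalZ /F !mevalM rmorphXn /= (fZ U ZU).
  rewrite expr0n subn_eq0 leqNgt ltn_neqAle qx andbT eq_sym.
  by rewrite (negPf xq : (x.1 == q :> nat) = false) !mul0r mulr0.
have [||gq0|hz] := vanishes_onM iZ _ _ gZ0.
- by exists (1 * (delta * (t - q)))%N; exact: dhomogMn.
- by exists w; apply: homogeneous_sum.
- case: gZ => U /gq0; rewrite rmorphXn => /eqP; rewrite expf_eq0.
  by case/andP=> _ /eqP.
move=> [x i] /= xq; have -> : x = Ordinal qt by exact: val_inj.
exact: (hI _ hz).
Qed.

(** The Hilbert function of Z_j grows at least like the j-th power of the degree:
    C depends on the chain only, not on t. *)
Lemma chain_independent (A : set Gr) m Z : irreducible_chain A m Z ->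
  forall j, (j <= m)%N -> exists C, forall t,
    exists (I : finType) (h : I -> {mpoly K[N]}),
      [/\ #|I| = (t ^ j)%N, forall i, h i \is (C * t).-homog
        & independent_on h (Z j)].
Proof.
move=> [hZ sZ].
have [U0 ZU0] : Z 0%N !=set0 by have [[]] := hZ 0%N isT.
have [g g1 gU0] := plucker_neq0 he U0.
have ZS j : (j <= m)%N -> Z 0%N `<=` Z j.
  elim: j => [_ U //|j IH jm U /(IH (ltnW jm))].
  by have [sub _] := sZ j jm; exact: sub.
elim=> [_|j IH jm].
  exists 0%N => t; exists unit, (fun=> 1); split; first by rewrite card_unit.
    by move=> _; rewrite mul0n; exact: dhomog1.
  move=> c c0 []; have := c0 U0 ZU0.
  rewrite meval_sumZ (bigD1 tt) //= big1 ?addr0; last by case.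
  by rewrite meval1 mulr1.
have [C hC] := IH (ltnW jm).
have [iZ [F cF ZE]] := hZ j (ltnW jm); have [iZ' [F' _ ZE']] := hZ j.+1 jm.
have [sub nsub] := sZ j jm.
have [U [Z'U nFU]] : exists U, Z j.+1 U /\ ~ F U.
  apply: contrapT => no; apply: nsub => U Z'U; rewrite ZE; split.
    by move: Z'U; rewrite ZE' => -[].
  by apply: contrapT => FU; apply: no; exists U.
have [f [[delta fd] fF /eqP fU]] := closed_separation cF nFU.
exists (delta + C)%N => t; have [I [h [cI hw hI]]] := hC t.
have fZ : vanishes_on f (Z j) by rewrite ZE => W [_ /fF].
have nfZ' : ~ vanishes_on f (Z j.+1) by move=> /(_ U Z'U).
have ngZ : ~ vanishes_on g (Z j).
  by move=> /(_ U0 (ZS j (ltnW jm) U0 ZU0)); apply/eqP.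
have [h' [hw' hI']] := independent_extend t iZ iZ' sub fd fZ nfZ' g1 ngZ hw hI.
exists ('I_t * I)%type, h'; split => //.
  by rewrite card_prod card_ord cI expnS.
by move=> i; rewrite mulnDl.
Qed.

(** The hypothesis says that A is contained in the closure of the set of planes
    spanned by the matrices X(y): it makes the pullback of forms from A to polynomials in d
    variables injective. *)
Lemma chain_length_le (A : set Gr) (d : nat)
    (X : 'M[{mpoly K[d]}]_(k, n)) :
  (forall f, homogeneous f ->
     (forall y : 'I_d -> K, f.@[minors (map_mx (meval y) X)] = 0) ->
     vanishes_on f A) ->
  forall m Z, irreducible_chain A m Z -> (m <= d)%N.
Proof.
move=> XA m Z hZ; rewrite leqNgt; apply/negP => dm.
have [C hC] := chain_independent hZ (leqnn m).
pose D := (\max_i msize (minors X i))%N.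
(* With this t, (C t D + 1) ^ d <= t ^ d (C D + 1) ^ d < t ^ d.+1 <= t ^ m. *)
pose t := ((C * D).+1 ^ d).+1.
have [I [h [cI hw hI]]] := hC t.
pose P i := mmap (@mpolyC d K) (minors X) (h i).
have Pb i : (msize (P i) <= (C * t * D).+1)%N.
  apply: msize_mmap_homog => // j.
  by rewrite ltnW // ltnS (leq_bigmax j).
have lt : ((C * t * D).+1 ^ d < #|I|)%N.
  rewrite cI; apply: (@leq_ltn_trans ((t * (C * D).+1) ^ d)%N).
    case: (d) => // d'; rewrite leq_exp2r // mulnS (mulnC C) -mulnA.
    by rewrite -[X in (X <= _)%N]add1n leq_add2r.
  rewrite expnMn (@leq_trans (t ^ d.+1)) ?leq_pexp2l //.
  by rewrite expnSr ltn_pmul2l ?expn_gt0.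
have [c [[i ci] c0]] := mpoly_dependent Pb lt.
case/eqP: ci; apply: hI => U; have [_ [F _ ->]] := hZ.1 m (leqnn m).
case=> AU _; apply: XA AU => [|y].
  by exists (C * t)%N; exact: homogeneous_sum.
rewrite meval_sumZ -[RHS](meval0 y) -c0 meval_sumZ; apply: eq_bigr => a _.
congr (_ * _); rewrite /P rmorph_mmap; apply: eq_mmap => [b|j] /=.
  by rewrite mevalC.
by rewrite minors_map.
Qed.

End Chains.

(** * The normal form of a basis adapted to a rank set *)

Section NormalForm.
Variables (k n : nat) (M : rank_set k n).
Local Notation l := (lft M).
Local Notation r := (rgt M).

Definition nested (j i : 'I_k) := (l i <= l j)%N && (r j <= r i)%N.

Definition free_positions : {set 'I_k * 'I_n} :=
  [set p : 'I_k * 'I_n | (l p.1 <= p.2 <= r p.1)%N &&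
     [forall j, nested j p.1 ==> (l j != p.2)]]%SET.

Local Notation d := #|free_positions|.

(** The row of index i is e_(l i) plus a free linear combination of the e_c with
    (i, c) a free position.  The ring is arbitrary so that the matrix can be
    taken with polynomial entries. *)
Definition normal_form (B : comNzRingType) (y : 'I_d -> B) : 'M[B]_(k, n) :=
  \matrix_(i, c) ((c == l i)%:R + \sum_s (enum_val s == (i, c))%:R * y s).

Lemma nested_refl i : nested i i. Proof. by rewrite /nested !leqnn. Qed.

Lemma free_positionP (i : 'I_k) (c : 'I_n) : reflect
  ((l i <= c <= r i)%N /\ forall j, nested j i -> l j != c)
  ((i, c) \in free_positions).
Proof.
rewrite inE; apply: (iffP andP) => -[ic /= h]; split => //.
  by move=> j ji; move/forallP/(_ j)/implyP/(_ ji): h.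
by apply/forallP => j; apply/implyP/h.
Qed.

Section Entries.
Variables (B : comNzRingType) (y : 'I_d -> B).

Lemma normal_form_free s :
  normal_form y (enum_val s).1 (enum_val s).2 = y s.
Proof.
have := enum_valP s; case E: (enum_val s) => [i c] /free_positionP[_ /(_ i)].
move=> /(_ (nested_refl i)) /negPf lc; rewrite mxE eq_sym lc add0r.
rewrite (bigD1 s) //= E eqxx mul1r big1 ?addr0 // => s' s's.
case: eqP => [E'|_]; last by rewrite mul0r.
by case/eqP: s's; apply: enum_val_inj; rewrite E' E.
Qed.

Lemma normal_form_fixed (i : 'I_k) (c : 'I_n) : (i, c) \notin free_positions ->
  normal_form y i c = (c == l i)%:R.
Proof.
move=> ic; rewrite mxE big1 ?addr0 // => s _.
case: eqP => [E|_]; last by rewrite mul0r.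
by case/negP: ic; rewrite -E enum_valP.
Qed.

Lemma normal_form_lft i : normal_form y i (l i) = 1.
Proof.
rewrite normal_form_fixed ?eqxx //; apply/negP => /free_positionP[_ /(_ i)].
by rewrite eqxx => /(_ (nested_refl i)).
Qed.

Lemma normal_form_nested i j : nested j i -> j != i -> normal_form y i (l j) = 0.
Proof.
move=> ji n_ji; rewrite normal_form_fixed.
  by rewrite (inj_eq (@lft_inj _ _ M)) (negPf n_ji).
by apply/negP => /free_positionP[_ /(_ j ji)]; rewrite eqxx.
Qed.

Lemma normal_form_out (i : 'I_k) (c : 'I_n) : ~~ (l i <= c <= r i)%N ->
  normal_form y i c = 0.
Proof.
move=> ic; rewrite normal_form_fixed.
  by case: eqP ic => // ->; rewrite leqnn (lft_le_rgt M i).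
by apply/negP => /free_positionP[ic']; rewrite ic' in ic.
Qed.

End Entries.

Lemma map_normal_form (B C : comNzRingType) (phi : {rmorphism B -> C})
    (y : 'I_d -> B) :
  map_mx phi (normal_form y) = normal_form (phi \o y).
Proof.
apply/matrixP => i c; rewrite !mxE rmorphD rmorph_nat rmorph_sum; congr (_ + _).
by apply: eq_bigr => s _; rewrite rmorphM rmorph_nat.
Qed.

(** With the rows and columns sorted by l, this minor is upper triangular. *)
Lemma det_lft_minor (B : comPzRingType) (A : 'M[B]_(k, n)) :
  (forall (i : 'I_k) (c : 'I_n), (c < l i)%N -> A i c = 0) ->
  \det (\matrix_(a < k, b < k) A a (l b)) = \prod_i A i (l i).
Proof.
move=> hA; rewrite (@det_triangular_weight _ _ (fun a => l a)).
  by apply: eq_bigr => i _; rewrite mxE.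
move=> a b ab; rewrite mxE => Aab; rewrite ltn_neqAle.
rewrite (inj_eq val_inj) (inj_eq (@lft_inj _ _ M)) ab leqNgt.
by apply: contra Aab => /hA ->.
Qed.

Section OverField.
Variables (K : fieldType).

Lemma row_free_minor (c : 'I_k -> 'I_n) (A : 'M[K]_(k, n)) :
  \det (\matrix_(a < k, b < k) A a (c b)) != 0 -> row_free A.
Proof.
rewrite -unitfE -unitmxE -row_free_unit => Af.
rewrite -kermx_eq0; apply/rowV0P => v /sub_kermxP vA.
apply/eqP; rewrite -(mulmx_free_eq0 _ Af); apply/eqP/rowP => b.
have /rowP/(_ (c b)) := vA; rewrite !mxE => h; rewrite -[RHS]h.
by apply: eq_bigr => a _; rewrite mxE.
Qed.

Lemma row_free_lft (A : 'M[K]_(k, n)) :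
  (forall (i : 'I_k) (c : 'I_n), (c < l i)%N -> A i c = 0) ->
  (forall i, A i (l i) != 0) ->
  row_free A.
Proof.
move=> hA dA; apply: (@row_free_minor l); rewrite det_lft_minor //.
by apply/prodf_neq0 => i _.
Qed.

Lemma row_free_normal_form (y : 'I_d -> K) : row_free (normal_form y).
Proof.
apply: row_free_lft => [i c ci|i]; last by rewrite normal_form_lft oner_eq0.
by apply: normal_form_out; rewrite leqNgt ci.
Qed.

(** Row i of the multiplier g combines only the rows nested in i, which keeps the
    result in W_i, and must take the value 1 at l i and 0 at the other l j with
    j nested in i.  This is a linear system whose matrix D i is triangular for the weight l. *)
Lemma normal_form_reduction (A : 'M[K]_(k, n)) :
  (forall (i : 'I_k) (c : 'I_n), ~~ (l i <= c <= r i)%N -> A i c = 0) ->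
  (forall i, A i (l i) != 0) ->
  exists y g, normal_form y = g *m A.
Proof.
move=> hA dA.
have [g gE] : exists g : 'M[K]_k, forall i,
    (forall j, ~~ nested j i -> g i j = 0) /\
    (forall j, nested j i -> \sum_a g i a * A a (l j) = (i == j)%:R).
  (* Outside of the rows nested in i, D i is completed by the identity. *)
  pose D i : 'M[K]_k := \matrix_(a, b)
    if nested a i then (if nested b i then A a (l b) else 0) else (a == b)%:R.
  have Du i : D i \in unitmx.
    rewrite unitmxE unitfE (@det_triangular_weight _ _ (fun a => l a)).
      apply/prodf_neq0 => a _; rewrite mxE eqxx.
      by case: (nested a i); rewrite ?dA ?oner_eq0.
    move=> a b ab; rewrite mxE (negPf ab).
    case: (nested a i); last by rewrite eqxx.
    case: (nested b i); last by rewrite eqxx.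
    move=> Aab; rewrite ltn_neqAle.
    rewrite (inj_eq val_inj) (inj_eq (@lft_inj _ _ M)) ab leqNgt.
    by apply: contra Aab => ba; rewrite hA // leqNgt ba.
  pose g : 'M[K]_k := \matrix_(i, j) invmx (D i) i j.
  have gD i j : \sum_a g i a * D i a j = (i == j)%:R.
    have /matrixP/(_ i j) := mulVmx (Du i); rewrite !mxE => <-.
    by apply: eq_bigr => a _; rewrite [g _ _]mxE.
  have g0 i j : ~~ nested j i -> g i j = 0.
    move=> nji; have := gD i j; rewrite (bigD1 j) //= big1 ?addr0.
      rewrite [D i _ _]mxE (negPf nji) eqxx mulr1 => ->; case: eqP => // ij.
      by rewrite -ij nested_refl in nji.
    move=> a aj; rewrite [D i _ _]mxE (negPf nji) (negPf aj) if_same.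
    by rewrite mulr0.
  exists g => i; split=> [j /g0 //|j ji]; rewrite -gD; apply: eq_bigr => a _.
  have [ai|nai] := boolP (nested a i); first by rewrite [D _ _ _]mxE ai ji.
  by rewrite g0 // !mul0r.
exists (fun s => (g *m A) (enum_val s).1 (enum_val s).2), g.
apply/matrixP => i c.
have [ic|nic] := boolP ((i, c) \in free_positions).
  have := normal_form_free (fun s => (g *m A) (enum_val s).1 (enum_val s).2)
    (enum_rank_in ic (i, c)).
  by rewrite enum_rankK_in.
rewrite normal_form_fixed // mxE.
have [out|] := boolP (~~ (l i <= c <= r i)%N).
  rewrite big1 => [|a _].
    by case: eqP out => // ->; rewrite leqnn (lft_le_rgt M i).
  have [ai|/(proj1 (gE i))->] := boolP (nested a i); last by rewrite mul0r.
  rewrite hA ?mulr0 //; apply: contra out; move: ai => /andP[].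
  by move=> la ra /andP[ca ac]; rewrite (leq_trans la ca) (leq_trans ac ra).
rewrite negbK => ic.
have [j ji lj] : exists2 j, nested j i & l j = c.
  apply: contrapT => no; case/negP: nic; apply/free_positionP; split=> // j ji.
  by apply/eqP => lj; apply: no; exists j.
by rewrite -lj (proj2 (gE i)) // (inj_eq (@lft_inj _ _ M)) eq_sym.
Qed.

End OverField.
End NormalForm.

(** * Rank spaces and the dimension formula *)

Section RankSpaces.
Variables (k n : nat) (K : fieldType) (V : vectType K) (e : n.-tuple V).
Hypothesis he : basis_of fullv e.
Variable M : rank_set k n.
Local Notation l := (lft M).
Local Notation r := (rgt M).

Lemma mem_rank_space i v : reflect
  (forall c : 'I_n, ~~ (l i <= c <= r i)%N -> coord e c v = 0)
  (v \in rank_space e M i).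
Proof.
apply: (iffP idP) => [vW c ic|h].
  suff /subvP/(_ v vW) :
      (rank_space e M i <= lker (linfun (coord e c : V -> K^o)))%VS.
    by rewrite memv_ker lfunE => /eqP.
  apply/span_subvP => w /mapP[j]; rewrite mem_index_iota => ij ->.
  have jn : (j < n)%N by have := ltn_ord (r i); lia.
  rewrite memv_ker lfunE /= (coord_free (Ordinal jn) c (basis_free he)).
  case: (Ordinal jn =P c) ic => [<-|_ _]; last by rewrite eqxx.
  by move=> /=; lia.
rewrite (coord_basis he (memvf v)) memv_suml // => c _.
have [ic|/h->] := boolP (l i <= c <= r i)%N; last by rewrite scale0r mem0v.
apply/memvZ/memv_span/mapP; exists (c : nat) => //.
by rewrite mem_index_iota ltnS.
Qed.

Lemma rank_space_subset i j :
  (rank_space e M j <= rank_space e M i)%VS = nested M j i.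
Proof.
apply/idP/andP => [ji|[li ri]].
  have hc (c : 'I_n) : (l j <= c <= r j)%N -> (l i <= c <= r i)%N.
    move=> cj; apply/negPn/negP => ci.
    have /(subvP ji)/mem_rank_space/(_ c ci)/eqP : e`_c \in rank_space e M j.
      apply/mem_rank_space => c' nc'; rewrite coord_free ?(basis_free he) //.
      by case: (c =P c') nc' => // <-; rewrite cj.
    by rewrite coord_free ?(basis_free he) // eqxx oner_eq0.
  have := lft_le_rgt M j => lr.
  by have := hc (l j); have := hc (r j); lia.
apply/subvP => v /mem_rank_space vj; apply/mem_rank_space => c ci.
by apply: vj; apply: contra ci; lia.
Qed.

Lemma dim_rank_space i :
  \dim (rank_space e M i) = #|[set c : 'I_n | (l i <= c <= r i)%N]%SET|.
Proof.
have lr := lft_le_rgt M i; have rn := ltn_ord (r i).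
have -> : rank_space e M i = <<take ((r i).+1 - l i) (drop (l i) e)>>%VS.
  rewrite /rank_space; congr (<<_>>%VS).
  have sz : size (drop (l i) e) = (n - l i)%N by rewrite size_drop size_tuple.
  apply: (@eq_from_nth _ 0) => [|j].
    by rewrite size_map size_iota size_take sz; case: ltnP => //; lia.
  rewrite size_map size_iota => jr.
  by rewrite (nth_map 0%N) ?size_iota // nth_iota // nth_take // nth_drop.
have /eqP -> : free (take ((r i).+1 - l i) (drop (l i) e)).
  apply: (@catl_free _ _ (drop ((r i).+1 - l i) (drop (l i) e))).
  rewrite cat_take_drop; apply: (@catr_free _ _ (take (l i) e)).
  by rewrite cat_take_drop (basis_free he).
have -> : size (take ((r i).+1 - l i) (drop (l i) e)) = ((r i).+1 - l i)%N.
  by rewrite size_take size_drop size_tuple; case: ltnP => //; lia.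
rewrite -sum1_card -[LHS]muln1 -sum_nat_const_nat.
rewrite (@big_nat_widenl _ _ _ _ 0%N) // (@big_nat_widen _ _ _ _ _ n) // big_mkord.
by apply: eq_bigl => c; rewrite inE ltnS.
Qed.

Lemma card_free_positions :
  #|free_positions M|%:Z = \sum_(i < k) (\dim (rank_space e M i))%:Z
     - \sum_(i < k)
         #|[set j | (rank_space e M j <= rank_space e M i)%VS]%SET|%:Z.
Proof.
have row i : \dim (rank_space e M i)
    = (#|[set c | (i, c) \in free_positions M]%SET|
      + #|[set j | (rank_space e M j <= rank_space e M i)%VS]%SET|)%N.
  rewrite dim_rank_space -[X in (_ + X)%N](card_imset _ (@lft_inj _ _ M)).
  set F := [set c | _]%SET; set S := (_ @: _)%SET.
  have -> : [set c : 'I_n | (l i <= c <= r i)%N]%SET = (F :|: S)%SET.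
    apply/setP => c; apply/idP/setUP => [|[|/imsetP[j + ->]]]; rewrite inE.
    - move=> ic; have [cF|ncF] := boolP ((i, c) \in free_positions M).
        by left; rewrite inE.
      right; apply: contrapT => no; case/negP: ncF; apply/free_positionP.
      split=> // j ji; apply/eqP => lj; apply: no; apply/imsetP; exists j => //.
      by rewrite inE rank_space_subset.
    - by rewrite /F inE => /free_positionP[].
    rewrite rank_space_subset => /andP[li ri]; rewrite inE li.
    exact: leq_trans (lft_le_rgt M j) ri.
  rewrite cardsU disjoint_setI0 ?cards0 ?subn0 //.
  rewrite disjoint_subset; apply/fintype.subsetP => c cF.
  have /free_positionP[_ h] : (i, c) \in free_positions M by rewrite inE in cF.
  rewrite inE; apply/negP => /imsetP[j]; rewrite inE.
  by rewrite rank_space_subset => /h /eqP nlj cj; apply: nlj.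
under [in RHS]eq_bigr do rewrite row.
rewrite -sumrB; under [RHS]eq_bigr do rewrite PoszD addrK.
rewrite -[RHS](big_morph _ PoszD (erefl : 0%:Z = 0)); congr Posz.
pose F i := [set c | (i, c) \in free_positions M]%SET.
rewrite -sum1_card (eq_bigl (fun p => true && (p.2 \in F p.1))).
  rewrite -(pair_big_dep xpredT (fun i c => c \in F i) (fun _ _ => 1%N)) /=.
  by apply: eq_bigr => i _; rewrite sum1_card.
by move=> [i c]; rewrite /F inE.
Qed.
End RankSpaces.

(** * Affine coordinates near the base point *)

Section Coordinates.
Variables (k n : nat) (M : rank_set k n) (K : fieldType).
Local Notation l := (lft M).
Local Notation r := (rgt M).
Local Notation d := #|free_positions M|.

(** The parameters of b_i = e_(l i) + e_(r i), or b_i = e_(l i) if l i = r i. *)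
Definition base_point : 'I_d -> K :=
  fun s => ((enum_val s).2 == r (enum_val s).1)%:R.

Lemma base_point_supp i (c : 'I_n) : normal_form base_point i c != 0 ->
  c = l i \/ c = r i.
Proof.
have [ic|ic] := boolP ((i, c) \in free_positions M).
  have := normal_form_free base_point (enum_rank_in ic (i, c)).
  rewrite /base_point enum_rankK_in //= => ->.
  by case: (c =P r i) => [->|_]; [right | rewrite eqxx].
by rewrite normal_form_fixed //; case: (c =P l i) => [->|_]; [left | rewrite eqxx].
Qed.

Lemma base_point_rgt i : normal_form base_point i (r i) = 1.
Proof.
have [ic|ic] := boolP ((i, r i) \in free_positions M).
  have := normal_form_free base_point (enum_rank_in ic (i, r i)).
  by rewrite /base_point enum_rankK_in //= eqxx.
have [->|lr] := eqVneq (r i) (l i); first exact: normal_form_lft.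
case/negP: ic; apply/free_positionP; rewrite leqnn lft_le_rgt; split=> // j.
move=> /andP[lj rj]; apply/eqP => ljr; case/eqP: lr.
suff ji : j = i by rewrite -ljr ji.
apply: (@rgt_inj _ _ M); apply: val_inj; apply/eqP.
by rewrite eqn_leq rj -ljr lft_le_rgt.
Qed.

(** Columns that isolate row i of the normal form: the column attached to j <> i
    lies outside of W_i, or is the cleared coordinate l j if j is nested in
    i. *)
Definition chart_column (i j : 'I_k) : 'I_n :=
  if (r i < r j)%N && (l i <= l j)%N then r j else l j.

Definition chart_num (i : 'I_k) (c : 'I_n) (A : 'M[K]_(k, n)) : K :=
  \det (\matrix_(a < k, b < k) A a (if b == i then c else chart_column i b)).
Definition chart_den (i : 'I_k) (A : 'M[K]_(k, n)) : K :=
  \det (\matrix_(a < k, b < k) A a (chart_column i b)).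

(** Row i of both determinants is concentrated in its i-th entry, which is the
    parameter in one case and 1 in the other, with the same cofactor. *)
Lemma chart_ratio (y : 'I_d -> K) s :
  chart_num (enum_val s).1 (enum_val s).2 (normal_form y)
  = y s * chart_den (enum_val s).1 (normal_form y).
Proof.
set i := (enum_val s).1; set c := (enum_val s).2.
have row0 b : b != i -> normal_form y i (chart_column i b) = 0.
  move=> bi; rewrite /chart_column; case: ifPn => [/andP[rb _]|].
    by apply: normal_form_out; rewrite negb_and orbC -ltnNge rb.
  rewrite negb_and -leqNgt -ltnNge => h.
  have [li|il] := ltnP (l b) (l i).
    by apply: normal_form_out; rewrite negb_and -ltnNge li.
  apply: normal_form_nested => //; rewrite /nested il /=.
  by move: h; rewrite ltnNge il orbF.
rewrite /chart_num /chart_den (expand_det_row _ i) (bigD1 i) //=.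
rewrite [X in _ + X]big1 ?addr0; last first.
  by move=> b bi; rewrite mxE (negPf bi) row0 // mul0r.
rewrite [in RHS](expand_det_row _ i) [in RHS](bigD1 i) //=.
rewrite [X in _ * (_ + X)]big1 ?addr0; last first.
  by move=> b bi; rewrite mxE row0 // mul0r.
have yic : normal_form y i c = y s := normal_form_free y s.
rewrite [X in X * _ = _]mxE eqxx yic [X in _ = _ * (X * _)]mxE.
rewrite [chart_column i i]/chart_column ltnn /=.
rewrite normal_form_lft mul1r; congr (_ * (_ * \det _)).
by apply/matrixP => a b; rewrite !mxE [lift i b == i]eq_sym (negPf (neq_lift _ _)).
Qed.

(** At the base point the nonzero entries of row a lie in columns l a and r a
    only, which makes the matrix triangular once its rows are listed in the
    right order: first those with l a < l i, by increasing l; then those with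
    r i < r a, by decreasing l since r b = l a forces l b < l a; finally those
    nested in i, by increasing l. *)
Lemma chart_den_base_point i : chart_den i (normal_form base_point) != 0.
Proof.
pose rho (j : 'I_k) : nat := if (l j < l i)%N then l j : nat
  else if (r i < r j)%N then (n + (n - l j))%N else (3 * n + l j)%N.
rewrite /chart_den (@det_triangular_weight _ _ rho).
  apply/prodf_neq0 => j _; rewrite mxE /chart_column.
  by case: ifP => _; rewrite ?base_point_rgt ?normal_form_lft oner_eq0.
move=> a b ab; rewrite mxE => nz.
have [ca|] := boolP (l a <= chart_column i b <= r a)%N; last first.
  by move=> /(normal_form_out base_point) z; rewrite z eqxx in nz.
have lab : (l a : nat) != l b by rewrite (inj_eq val_inj) (inj_eq (@lft_inj _ _ M)).
have rab : (r a : nat) != r b by rewrite (inj_eq val_inj) (inj_eq (@rgt_inj _ _ M)).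
have := base_point_supp nz; move: ca; rewrite /rho /chart_column.
have := lft_le_rgt M b; have := ltn_ord (l a); have := ltn_ord (l b).
move=> ha hb hlr ca [] /(congr1 (@nat_of_ord n)); move: ca.
  by do !case: ifP; lia.
by do !case: ifP; lia.
Qed.

End Coordinates.

Arguments base_point {k n} M K s.

(** * Rank varieties as closures of images of affine spaces *)

Section RankVarieties.
Variables (k n : nat) (K : fieldType) (V : vectType K) (e : n.-tuple V).
Hypothesis he : basis_of fullv e.
Hypothesis Kinf : forall s : seq K, exists x, x \notin s.
Variable M : rank_set k n.
Local Notation l := (lft M).
Local Notation r := (rgt M).
Local Notation d := #|free_positions M|.
Local Notation Gr := (grassmannian k e).

Definition cell (L : set ('I_d -> K)) : set Gr :=
  [set U | exists2 y, L y & spans (normal_form y) U].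

Lemma spans_mulmx (A : 'M[K]_(k, n)) (g : 'M[K]_k) (U : Gr) :
  row_free (g *m A) -> spans A U -> spans (g *m A) U.
Proof.
move=> /(free_rows_span he)[U' AU'] AU; rewrite /spans.
apply/eqP; rewrite eqEdim AU' !dim_gr leqnn andbT -AU' -AU.
apply/span_subvP => v /tnthP[i ->]; rewrite tnth_mktuple.
rewrite (_ : \sum_c _ = \sum_b g i b *: (rows e A)`_b).
  by apply: memv_suml => b _; apply/memvZ/memv_span/mem_nth; rewrite size_tuple.
under [RHS]eq_bigr do rewrite nth_rows scaler_sumr.
rewrite exchange_big; apply: eq_bigr => c _ /=; rewrite mxE scaler_suml.
by apply: eq_bigr => b _; rewrite scalerA.
Qed.

Lemma at_mx_normal_form (y : 'I_d -> {poly K}) t :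
  at_mx (normal_form y) t = normal_form (fun s => (y s).[t]).
Proof. exact: map_normal_form. Qed.

Lemma cell_irreducible (L : set ('I_d -> K)) : L !=set0 ->
  (forall y1 y2 t, L y1 -> L y2 -> L (fun s => y1 s + t * (y2 s - y1 s))) ->
  irreducible (cell L).
Proof.
move=> [y0 Ly0] hL; apply: (irreducible_curves he Kinf).
  have [U U0] := free_rows_span he (row_free_normal_form y0).
  by exists U, y0.
move=> U1 U2 [y1 L1 s1] [y2 L2 s2].
exists (normal_form (fun s => (y1 s)%:P + 'X * (y2 s - y1 s)%:P)).
have E t : at_mx (normal_form (fun s => (y1 s)%:P + 'X * (y2 s - y1 s)%:P)) t
    = normal_form (fun s => y1 s + t * (y2 s - y1 s)).
  rewrite at_mx_normal_form; congr normal_form; apply/funext => s.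
  by rewrite !hornerE.
split=> [||t]; rewrite E.
- rewrite (_ : (fun s => _) = y1) //; apply/funext => s.
  by rewrite mul0r addr0.
- rewrite (_ : (fun s => _) = y2) //; apply/funext => s.
  by rewrite mul1r addrC subrK.
have [U sU] := free_rows_span he
  (row_free_normal_form (fun s => y1 s + t * (y2 s - y1 s))).
by exists U => //; exists (fun s => y1 s + t * (y2 s - y1 s)) => //; exact: hL.
Qed.

(** The reduction needs b_i(l i) to be nonzero for all i.  This holds for the
    perturbations b_i + t e_(l i) except for finitely many t. *)
Lemma rank_variety_cell : rank_variety e M = closure (cell setT).
Proof.
apply/seteqP; split.
  apply: closure_sub; first exact: closed_closure.
  move=> U [b [bU bW]].
  pose B := coord_mx e b.
  have BW (i : 'I_k) (c : 'I_n) : ~~ (l i <= c <= r i)%N -> B i c = 0.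
    by move=> ic; rewrite mxE -tnth_nth; apply/(mem_rank_space he): c ic.
  pose A : 'M[{poly K}]_(k, n) :=
    \matrix_(i, c) ((B i c)%:P + 'X * (c == l i)%:R).
  have AE t i c : at_mx A t i c = B i c + t * (c == l i)%:R.
    by rewrite !mxE /horner_eval !hornerE -polyC_natr hornerC.
  pose Q := \prod_i ((B i (l i))%:P + 'X).
  apply: (curve_limit he Kinf (A := A) (Q := Q)).
  - rewrite /spans -(span_basis bU); congr (<<_>>%VS).
    rewrite -[RHS](congr1 val (coord_mxK he b)); congr (val (rows e _)).
    by apply/matrixP => i c; rewrite AE mul0r addr0.
  - apply/prodf_neq0 => i _; rewrite addrC -[_%:P]opprK -polyCN.
    by rewrite polyXsubC_eq0.
  move=> t Qt.
  have dA i : at_mx A t i (l i) != 0.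
    move: Qt; rewrite horner_prod => /prodf_neq0/(_ i isT).
    by rewrite AE !hornerE eqxx mulr1.
  have AW (i : 'I_k) (c : 'I_n) : ~~ (l i <= c <= r i)%N -> at_mx A t i c = 0.
    move=> ic; rewrite AE BW // add0r.
    case: eqP ic => [->|]; last by rewrite mulr0.
    by rewrite leqnn (lft_le_rgt M i).
  have [W AtW] : exists W : Gr, spans (at_mx A t) W.
    apply: free_rows_span => //; apply: (row_free_lft (M := M)) => // i c ci.
    by apply: AW; rewrite leqNgt ci.
  exists W => //; have [y [g yE]] := normal_form_reduction AW dA.
  exists y => //; rewrite yE; apply: spans_mulmx => //.
  by rewrite -yE row_free_normal_form.
apply: closureS => U [y _ yU]; exists (rows e (normal_form y)); split.
  rewrite basisEdim yU subvv size_tuple dim_gr.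
  exact: leqnn.
move=> i; apply/(mem_rank_space he) => c ic.
by rewrite (tnth_nth 0) coord_rows // normal_form_out.
Qed.

(** The coordinate subspace of dimension t through the base point. *)
Definition flag (t : nat) : set ('I_d -> K) :=
  [set y | forall s : 'I_d, (t <= s)%N -> y s = base_point M K s].

Lemma flag_irreducible t : irreducible (closure (cell (flag t))).
Proof.
apply/irreducible_closure/cell_irreducible; first by exists (base_point M K).
move=> y1 y2 x h1 h2 s ts.
by rewrite h1 // h2 // subrr mulr0 addr0.
Qed.

Lemma flag_full : flag d = setT.
Proof. by apply/seteqP; split=> y // _ s; rewrite leqNgt ltn_ord. Qed.

Lemma flagS t u : (t <= u)%N -> cell (flag t) `<=` cell (flag u).
Proof.
by move=> tu U [y hy yU]; exists y => // s us; apply/hy/(leq_trans tu us).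
Qed.

(** The form (numerator) - (base value) * (denominator) of the t-th coordinate
    vanishes on the smaller set.  On the larger one the coordinate is free to
    move away from the base value, and the denominator, nonzero at the base
    point, is nonzero for almost all its values. *)
Lemma flag_strict t : (t < d)%N ->
  closure (cell (flag t)) `<` closure (cell (flag t.+1)).
Proof.
move=> td; split; first exact/closureS/flagS.
pose s := Ordinal td; pose i := (enum_val s).1; pose c := (enum_val s).2.
have [p p1 pE] := minor_form K (fun b => if b == i then c else chart_column M i b).
have [q q1 qE] := minor_form K (chart_column M i).
pose x0 := base_point M K; pose f := p - x0 s *: q.
have hf : homogeneous f.
  by exists 1%N; apply: dhomogD => //; rewrite dhomogN; exact: dhomogZ.
have fE y : f.@[minors (normal_form y)]
    = (y s - x0 s) * chart_den M i (normal_form y).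
  by rewrite mevalB mevalZ pE qE -/(chart_num M i c _) -/(chart_den M i _)
    chart_ratio mulrBl.
have f0 : vanishes_on f (closure (cell (flag t))).
  apply: vanishes_on_closure => // U [y yt yU].
  by apply/(spans_plucker he yU hf); rewrite fE yt // subrr mul0r.
move=> sub.
pose A : 'M[{poly K}]_(k, n) :=
  normal_form (fun s' => (x0 s')%:P + 'X * (s' == s)%:R).
have AE v : at_mx A v = normal_form (fun s' => x0 s' + v * (s' == s)%:R).
  rewrite at_mx_normal_form; congr normal_form; apply/funext => s'.
  by rewrite !hornerE -polyC_natr hornerC.
have [P PE] := pullback_line A q.
have P0 : P != 0.
  apply/eqP => P0; have := PE 0; rewrite P0 horner0 AE qE => /esym/eqP.
  rewrite (_ : (fun s' => _) = x0) ?(negPf (chart_den_base_point M K i)) //.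
  by apply/funext => s'; rewrite mul0r addr0.
have [v] := infinite_nonroot Kinf (mulf_neq0 (negbT (polyX_eq0 K)) P0).
rewrite hornerM hornerX PE AE qE -/(chart_den M i _).
set y := (fun s' => _) => nz.
have ys : y s - x0 s = v by rewrite /y eqxx mulr1 addrC addKr.
have [U yU] := free_rows_span he (row_free_normal_form y).
have yL : flag t.+1 y.
  move=> s' ts'; rewrite /y; have [E|_] := eqVneq s' s; last by rewrite mulr0 addr0.
  by move: ts'; rewrite E ltnn.
have : f.@[plucker U] = 0.
  by apply/f0/sub/subset_closure; exists y.
by move=> /(spans_plucker he yU hf); rewrite fE ys; apply/eqP.
Qed.

Lemma rank_variety_dim : has_dim (rank_variety e M) d.
Proof.
rewrite rank_variety_cell; split.
  exists (fun t => closure (cell (flag t))); split=> t td; last exact: flag_strict.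
  split; first exact: flag_irreducible.
  exists (closure (cell (flag t))); first exact: closed_closure.
  apply/esym/setIidr; rewrite -flag_full; exact/closureS/flagS.
apply: (chain_length_le he (X := normal_form (fun s => 'X_s))) => f hf h.
apply: vanishes_on_closure => // U [y _ yU]; apply/(spans_plucker he yU hf).
rewrite -(h y) map_normal_form; apply: meval_eq => i.
congr (minors (normal_form _) i).
by apply/funext => s /=; rewrite mevalXU.
Qed.

Lemma rank_variety_irreducible : irreducible (rank_variety e M).
Proof. rewrite rank_variety_cell -flag_full; exact: flag_irreducible. Qed.

End RankVarieties.

Lemma numField_infinite (K : numFieldType) (s : seq K) : exists x, x \notin s.
Proof.
apply: contrapT => no.
have sub : {subset [seq i%:R | i <- iota 0 (size s).+1] <= s}.
  by move=> x _; apply/negPn/negP => xs; apply: no; exists x.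
have u : uniq [seq i%:R : K | i <- iota 0 (size s).+1].
  rewrite map_inj_uniq ?iota_uniq // => a b /eqP.
  by rewrite Num.Theory.eqr_nat => /eqP.
by have := uniq_leq_size u sub; rewrite size_map size_iota ltnn.
Qed.

Theorem lemma4p12 (R : realType) (k n : nat) (V : vectType R[i])
  (e : n.-tuple V) (he : basis_of fullv e) (M : rank_set k n) :
  [/\ closed (rank_variety e M),
      irreducible (rank_variety e M)
    & exists2 d : nat, has_dim (rank_variety e M) d
      & d%:Z = \sum_(i < k) (\dim (rank_space e M i))%:Z
               - \sum_(i < k)
                   #|[set j | (rank_space e M j <= rank_space e M i)%VS]%SET|%:Z].
Proof.
have Kinf := @numField_infinite R[i]; split.
- exact: closed_closure.
- exact: rank_variety_irreducible.
exists #|free_positions M|; first exact: rank_variety_dim.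
exact: card_free_positions.
Qed.
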